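(* For every $d\ge 1$ there are uncountably many congruence classes of B-tilings in $\mathbb H^{d+1}$ (all with the same prototile $B$), where two tilings are congruent if some isometry of $\mathbb H^{d+1}$ maps one to the other.
   Context: Use the upper half-space model $\mathbb H^{d+1}=\{(x,y): x\in\mathbb R^d,\ y>0\}$ with metric $(|dx|^2+dy^2)/y^2$. The Böröczky prototile is $B=[-\tfrac12,\tfrac12]^d\times[\tfrac12,1]$. Its facets are: one $a$-facet $[-\tfrac12,\tfrac12]^d\times\{1\}$ (a unit Euclidean cube in a horosphere); $2^d$ $b$-facets $\{(x,\tfrac12): x\in[-\tfrac12,\tfrac12]^d,\ x_i\sigma_i\ge 0 \text{ for all } i\}$, one for each $\sigma\in\{-1,1\}^d$ (unit Euclidean cubes in a concentric horosphere at distance $\ln 2$); and $2d$ $c$-facets, $F\times[\tfrac12,1]$ with $F$ a facet of $[-\tfrac12,\tfrac12]^d$. The lower-dimensional faces of $B$ are the faces of the cubes that are $a$- or $b$-facets, and the sets $F\times[\tfrac12,1]$ with $F$ a face of $[-\tfrac12,\tfrac12]^d$ of dimension less than $d-1$. A B-tiling is a tiling of $\mathbb H^{d+1}$ by isometric copies of $B$ which is face-to-face (the intersection of any two tiles is empty or a common face of both); when $d=1$ it is also required that whenever two tiles share a $c$-edge, the orientations of that edge induced by the two tiles (from the $a$-edge towards the $b$-edges) agree. *)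

(* Defs.v *)
From HB Require Import structures.
From mathcomp Require Import all_boot all_order all_algebra.
From mathcomp Require Import all_classical all_reals all_analysis.
Set Implicit Arguments.
Unset Strict Implicit.
Unset Printing Implicit Defensive.
Import Order.TTheory GRing.Theory Num.Theory.
Import numFieldNormedType.Exports.
Local Open Scope classical_set_scope.
Local Open Scope ring_scope.

Definition halfspace (R : realType) (d : nat) : set ('rV[R]_d * R) :=
  [set p | 0 < p.2].

(* The Riemannian metric (|dx|^2 + dy^2) / y^2 at p, as a bilinear form
   in the tangent vectors u and v. *)
Definition hyp_metric (R : realType) (d : nat) (p u v : 'rV[R]_d * R) : R :=
  ((\sum_(i < d) u.1 ord0 i * v.1 ord0 i) + u.2 * v.2) / p.2 ^+ 2.

(* Riemannian isometries of the half-space: diffeomorphisms preserving the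
   metric.  Maps are total on R^d x R, but only their values on the (open)
   half-space are constrained or used.  The norm of the library on R^d x R is
   a maximum norm; it defines the usual differentials. *)
Definition hyp_isometry (R : realType) (d : nat)
    (f : 'rV[R]_d * R -> 'rV[R]_d * R) : Prop :=
  let H := @halfspace R d in
  (exists g : 'rV[R]_d * R -> 'rV[R]_d * R,
    [/\ (forall p, H p -> H (f p)) /\ (forall p, H p -> H (g p)),
        (forall p, H p -> g (f p) = p) /\ (forall p, H p -> f (g p) = p) &
        (forall p, H p -> differentiable f p) /\
        (forall p, H p -> differentiable g p)]) /\
  (forall p u v, H p ->
    hyp_metric (f p) ('d f p u) ('d f p v) = hyp_metric p u v).

(* A face of the box with opposite corners lo <= hi: coordinate i is free if
   s i = None, and is fixed at hi_i (resp. lo_i) if s i = Some true (resp.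
   Some false).  Its dimension is the number of free coordinates; the box
   itself is the face without fixed coordinate. *)
Definition box_face (R : realType) (d : nat) (lo hi : 'rV[R]_d)
    (s : 'I_d -> option bool) : set 'rV[R]_d :=
  [set x | forall i : 'I_d,
    match s i with
    | None => (lo ord0 i <= x ord0 i) && (x ord0 i <= hi ord0 i)
    | Some b => x ord0 i = (if b then hi else lo) ord0 i
    end].

Definition face_dim (d : nat) (s : 'I_d -> option bool) : nat :=
  #|[pred i : 'I_d | s i == None]|.

(* Faces of the cube [-1/2, 1/2]^d. *)
Definition cube_face (R : realType) (d : nat) (s : 'I_d -> option bool) :
    set 'rV[R]_d :=
  box_face (const_mx (- 2^-1)) (const_mx 2^-1) s.

(* Faces of {x in [-1/2, 1/2]^d | x_i sigma_i >= 0 for all i}, where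
   sigma_i = 1 if sg i = true and sigma_i = -1 otherwise. *)
Definition subcube_face (R : realType) (d : nat) (sg : 'I_d -> bool)
    (s : 'I_d -> option bool) : set 'rV[R]_d :=
  box_face (\row_i (if sg i then 0 else - 2^-1))
           (\row_i (if sg i then 2^-1 else 0)) s.

Definition prototile (R : realType) (d : nat) : set ('rV[R]_d * R) :=
  [set p : 'rV[R]_d * R |
    (forall i : 'I_d, - 2^-1 <= p.1 ord0 i <= 2^-1) /\ 2^-1 <= p.2 <= 1].

(* The facets and lower-dimensional faces of the prototile. *)
Inductive prototile_face (R : realType) (d : nat) :
    set ('rV[R]_d * R) -> Prop :=
(* the a-facet and its faces *)
| PFa (s : 'I_d -> option bool) :
    prototile_face (@cube_face R d s `*` [set 1])
(* the b-facets and their faces *)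
| PFb (sg : 'I_d -> bool) (s : 'I_d -> option bool) :
    prototile_face (@subcube_face R d sg s `*` [set 2^-1])
(* the c-facets (face_dim s = d - 1) and the lower-dimensional vertical
   faces *)
| PFc (s : 'I_d -> option bool) : (face_dim s < d)%N ->
    prototile_face (@cube_face R d s `*` [set y | 2^-1 <= y <= 1]).

(* Isometric copies of the prototile. *)
Definition is_tile (R : realType) (d : nat) (t : set ('rV[R]_d * R)) : Prop :=
  exists2 f, hyp_isometry f & t = f @` @prototile R d.

Definition tile_face (R : realType) (d : nat) (t F : set ('rV[R]_d * R)) :
    Prop :=
  exists f, [/\ hyp_isometry f, t = f @` @prototile R d &
    exists2 G, prototile_face G & F = f @` G].

Definition is_tiling (R : realType) (d : nat)
    (T : set (set ('rV[R]_d * R))) : Prop :=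
  [/\ forall t, T t -> is_tile t,
      \bigcup_(t in T) t = @halfspace R d &
      forall t t', T t -> T t' -> t <> t' -> interior t `&` interior t' = set0].

Definition face_to_face (R : realType) (d : nat)
    (T : set (set ('rV[R]_d * R))) : Prop :=
  forall t t', T t -> T t' -> t <> t' ->
    t `&` t' = set0 \/ (tile_face t (t `&` t') /\ tile_face t' (t `&` t')).

(* E is the image in t of a vertical edge {v} x [1/2, 1], v being a vertex of
   the cube; p (on the a-facet of t) is its origin and q (on b-facets of t) its
   end for the orientation induced by t.  For d = 1 these edges are the
   c-edges of t. *)
Definition oriented_cedge (R : realType) (d : nat)
    (t E : set ('rV[R]_d * R)) (p q : 'rV[R]_d * R) : Prop :=
  exists f, [/\ hyp_isometry f, t = f @` @prototile R d &
    exists s : 'I_d -> bool,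
      let v : 'rV[R]_d := \row_i (if s i then 2^-1 else - 2^-1) in
      [/\ E = f @` ([set v] `*` [set y | 2^-1 <= y <= 1]),
          p = f (v, 1) & q = f (v, 2^-1)]].

Definition cedge_orientations_agree (R : realType) (d : nat)
    (T : set (set ('rV[R]_d * R))) : Prop :=
  forall t t' E p q p' q', T t -> T t' -> t <> t' ->
    oriented_cedge t E p q -> oriented_cedge t' E p' q' -> p = p' /\ q = q'.

Definition B_tiling (R : realType) (d : nat)
    (T : set (set ('rV[R]_d * R))) : Prop :=
  [/\ is_tiling T, face_to_face T & d = 1%N -> cedge_orientations_agree T].

Definition congruent (R : realType) (d : nat)
    (T T' : set (set ('rV[R]_d * R))) : Prop :=
  exists2 f : 'rV[R]_d * R -> 'rV[R]_d * R,
    hyp_isometry f & T' = [set f @` t | t in T].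

(* The congruence class of T among B-tilings. *)
Definition congruence_class (R : realType) (d : nat)
    (T : set (set ('rV[R]_d * R))) : set (set (set ('rV[R]_d * R))) :=
  [set T' | B_tiling T' /\ congruent T T'].

(* Main.v *)
Require Import Defs.
From HB Require Import structures.
From mathcomp Require Import all_boot all_order all_algebra.
From mathcomp Require Import ring lra zify.
From mathcomp Require Import all_classical all_reals all_analysis.
Set Implicit Arguments.
Unset Strict Implicit.
Unset Printing Implicit Defensive.
Import Order.TTheory GRing.Theory Num.Theory.
Import numFieldNormedType.Exports.
Local Open Scope classical_set_scope.
Local Open Scope ring_scope.

(** Stacking the tiles in horizontal layers, each layer n > 0 offers 2^d ways of
    grouping the cubes below it, so that a sequence w of binary digits (used for
    all coordinates at once) determines a B-tiling; distinct sequences give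
    distinct tilings, because the layer n reveals the first n digits.

    An isometry preserves the hyperbolic distance: composing with inversions, it
    suffices to bound the logarithm of the height along a vertical geodesic.  The
    diameter of the prototile is attained exactly at pairs of opposite bottom
    corners, hence an isometry that carries a tiling to a tiling carries bottom
    corners of tiles to bottom corners of tiles.  It is determined by the images of
    d + 2 bottom corners that are common to all the tilings, and these images range
    over a countable set (the heights are powers of 2 and the offsets natural
    numbers).  Hence a congruence class contains only countably many of the
    uncountably many tilings. *)

(** * Differential of the inversion *)

Section Differentials.
Variable R : realType.

Lemma scale_is_bilinear (V : normedModType R) :
  bilinear_for (GRing.Scale.Law.clone _ _ *:%R _)
    (GRing.Scale.Law.clone _ _ *:%R _) (@GRing.scale R V).
Proof.
split=> [u'|u] a x y /=; first by rewrite scalerDl scalerA.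
by rewrite scalerDr !scalerA mulrC.
Qed.

(** Product rule, read off from the differential of the bilinear map [*:%R] at [(k x, f x)]. *)
Lemma is_diff_scale (U V : normedModType R) (k dk : U -> R) (f df : U -> V) x :
  is_diff x k dk -> is_diff x f df ->
  is_diff x (fun z => k z *: f z) (fun u => k x *: df u + dk u *: f x).
Proof.
move=> kx fx.
pose B : {bilinear R -> V -> V} :=
  HB.pack (@GRing.scale R V)
    (bilinear_isBilinear.Build _ _ _ _ _ _ _ (@scale_is_bilinear V)).
have Bc : continuous (fun q : R * V => B q.1 q.2).
  by move=> q; apply: cvgZ; [exact: cvg_fst|exact: cvg_snd].
have Bd : is_diff (k x, f x) (fun q : R * V => B q.1 q.2)
    (fun q => B (k x) q.2 + B q.1 (f x)).
  by apply: DiffDef; [exact: differentiable_bilin|rewrite diff_bilin].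
exact: (is_diff_comp (is_diff_pair kx fx) Bd).
Qed.

Variable d : nat.
Local Notation V := ('rV[R]_d * R)%type.

(** Euclidean inner product, the numerator of [hyp_metric]; the maximum norm on the product space
    does not come from it. *)
Definition eip (u v : V) : R :=
  (\sum_(i < d) u.1 ord0 i * v.1 ord0 i) + u.2 * v.2.

Lemma eip_bilinear :
  bilinear_for (GRing.Scale.Law.clone _ _ *:%R _)
    (GRing.Scale.Law.clone _ _ *:%R _) eip.
Proof.
split=> [u'|u] a x y /=; rewrite /eip /=.
  under eq_bigr do rewrite !mxE mulrDl -mulrA.
  by rewrite big_split /= -mulr_sumr scalerDr addrACA mulrDl -mulrA.
under eq_bigr do rewrite !mxE mulrDr mulrCA.
by rewrite big_split /= -mulr_sumr scalerDr addrACA mulrDr mulrCA.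
Qed.
HB.instance Definition _ :=
  bilinear_isBilinear.Build _ _ _ _ _ _ eip eip_bilinear.

Lemma eip_continuous : continuous (fun q : V * V => eip q.1 q.2).
Proof.
move=> q.
have q1 : (fun q : V * V => q.1.1) @ q --> q.1.1.
  by apply: (@cvg_comp _ _ _ fst fst); exact: cvg_fst.
have q2 : (fun q : V * V => q.2.1) @ q --> q.2.1.
  by apply: (@cvg_comp _ _ _ snd fst); [exact: cvg_snd|exact: cvg_fst].
have q3 : (fun q : V * V => q.1.2) @ q --> q.1.2.
  by apply: (@cvg_comp _ _ _ fst snd); [exact: cvg_fst|exact: cvg_snd].
have q4 : (fun q : V * V => q.2.2) @ q --> q.2.2.
  by apply: (@cvg_comp _ _ _ snd snd); exact: cvg_snd.
apply: cvgD; last exact: cvgM.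
apply: cvg_big => [|i _]; first exact: add_continuous.
apply: cvgM.
  by apply: (cvg_comp _ (fun x : 'rV[R]_d => x ord0 i) q1); exact: coord_continuous.
by apply: (cvg_comp _ (fun x : 'rV[R]_d => x ord0 i) q2); exact: coord_continuous.
Qed.

Lemma eipC u v : eip u v = eip v u.
Proof. by rewrite /eip mulrC; congr (_ + _); apply: eq_bigr => i _; rewrite mulrC. Qed.

Lemma is_diff_eip_diag (p : V) :
  is_diff p (fun q => eip q q) (fun u => 2 * eip p u).
Proof.
have Bd : is_diff (p, p) (fun q : V * V => eip q.1 q.2)
    (fun q => eip p q.2 + eip q.1 p).
  apply: DiffDef; first exact: differentiable_bilin eip_continuous.
  by rewrite (diff_bilin _ eip_continuous).
apply: (is_diff_eq (is_diff_comp (is_diff_pair (is_diff_id p) (is_diff_id p)) Bd)).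
apply/funext => u /=.
by rewrite [eip u p]eipC -mulr2n mulr_natl.
Qed.

Lemma is_diff_inv (U : normedModType R) (f df : U -> R) x :
  f x != 0 -> is_diff x f df ->
  is_diff x (fun z => (f z)^-1) (fun u => - (f x) ^- 2 * df u).
Proof.
move=> f0 fx.
by apply: DiffDef; [exact: differentiableV|rewrite diffV // diff_val].
Qed.

(** Inversion in the unit sphere centred at the origin of the boundary. *)
Definition inversion (p : V) : V := (eip p p)^-1 *: p.

Lemma eip_gt0 (p : V) : 0 < p.2 -> 0 < eip p p.
Proof.
move=> p0; rewrite /eip ltr_wpDl ?mulr_gt0 //.
by apply: sumr_ge0 => i _; rewrite -expr2 sqr_ge0.
Qed.

Lemma is_diff_inversion (p : V) : 0 < p.2 ->
  is_diff p inversion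
    (fun u => (eip p p)^-1 *: u + (- (eip p p) ^- 2 * (2 * eip p u)) *: p).
Proof.
move=> p0; apply: is_diff_scale.
apply: (@is_diff_inv V (fun q => eip q q)); first by rewrite gt_eqF ?eip_gt0.
exact: is_diff_eip_diag.
Qed.

End Differentials.

(** * Riemannian isometries contract the hyperbolic distance *)

Section LocalIsometries.
Variables (R : realType) (d : nat).
Local Notation V := ('rV[R]_d * R)%type.

(** These conditions make distances non-increasing; equality for a [hyp_isometry] comes from
    treating its inverse in the same way. *)
Definition local_isometry (f : V -> V) : Prop :=
  [/\ forall p : V, 0 < p.2 -> 0 < (f p).2,
      forall p : V, 0 < p.2 -> differentiable f p &
      forall p u v : V, 0 < p.2 ->
        hyp_metric (f p) ('d f p u) ('d f p v) = hyp_metric p u v].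

Lemma local_isometry_comp f g :
  local_isometry f -> local_isometry g -> local_isometry (g \o f).
Proof.
move=> [fH fd fm] [gH gd gm]; split=> [p p0|p p0|p u v p0].
- exact/gH/fH.
- by apply: differentiable_comp; [exact: fd|exact/gd/fH].
- by rewrite diff_comp ?gm ?fm //; [exact: fH|exact: fd|exact/gd/fH].
Qed.

Definition sim (l : R) (b : 'rV[R]_d) (p : V) : V := l *: p + (b, 0).

Lemma is_diff_sim l b p : is_diff p (sim l b) ( *:%R l).
Proof.
apply: (is_diff_eq (is_diffD (is_diff_scaler l p) (is_diff_cst (b, 0) p))).
by rewrite addr0.
Qed.

Lemma eipDl (u v w : V) : eip (u + v) w = eip u w + eip v w :> R.
Proof. exact: (@linearDl _ _ _ _ _ _ (@eip R d)). Qed.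

Lemma eipDr (u v w : V) : eip u (v + w) = eip u v + eip u w :> R.
Proof. by rewrite eipC eipDl !(@eipC _ _ u). Qed.

Lemma eipZl (a : R) (u v : V) : eip (a *: u) v = a * eip u v :> R.
Proof.
rewrite /eip /= mulrDr mulr_sumr mulrA; congr (_ + _).
by apply: eq_bigr => i _; rewrite !mxE mulrA.
Qed.

Lemma eipZr (a : R) (u v : V) : eip u (a *: v) = a * eip u v :> R.
Proof. by rewrite eipC eipZl eipC. Qed.

Lemma eipNl (u v : V) : eip (- u) v = - eip u v :> R.
Proof. by rewrite -scaleN1r eipZl mulN1r. Qed.

Lemma eipNr (u v : V) : eip u (- v) = - eip u v :> R.
Proof. by rewrite eipC eipNl eipC. Qed.

Lemma hyp_metricE (p u v : V) : hyp_metric p u v = eip u v / p.2 ^+ 2 :> R.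
Proof. by []. Qed.

Lemma local_isometry_sim l b : 0 < l -> local_isometry (sim l b).
Proof.
move=> l0; split=> [p p0|p p0|p u v p0].
- by rewrite /= addr0 mulr_gt0.
- exact: (@ex_diff _ _ _ _ _ _ _ (is_diff_sim l b p)).
- rewrite (@diff_val _ _ _ _ _ _ _ (is_diff_sim l b p)) !hyp_metricE.
  rewrite eipZl eipZr /= addr0.
  have [? ?] : l != 0 /\ p.2 != 0 by rewrite !gt_eqF.
  by rewrite /GRing.scale /=; field; apply/andP.
Qed.

(** The differential at [p] is [(eip p p)^-1] times the reflection in the hyperplane orthogonal to
    [p], and the height is multiplied by the same factor. *)
Lemma local_isometry_inversion : local_isometry (@inversion R d).
Proof.
split=> [p p0|p p0|p u v p0].
- by rewrite /= mulr_gt0 // invr_gt0 eip_gt0.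
- exact: (@ex_diff _ _ _ _ _ _ _ (is_diff_inversion p0)).
- rewrite (@diff_val _ _ _ _ _ _ _ (is_diff_inversion p0)) !hyp_metricE.
  have N0 := eip_gt0 p0.
  rewrite !(eipDl, eipDr, eipZl, eipZr) (eipC u p) /=.
  have [? ?] : eip p p != 0 /\ p.2 != 0 by rewrite !gt_eqF.
  by rewrite /GRing.scale /=; field; apply/andP.
Qed.

(* chord p q = 2 (cosh (dist p q) - 1) *)
Definition chord (p q : V) : R := eip (p - q) (p - q) / (p.2 * q.2).

Lemma chordC p q : chord p q = chord q p.
Proof. by rewrite /chord -[p - q]opprB eipNl eipNr opprK mulrC [p.2 * _]mulrC mulrC. Qed.

Lemma chord_sim l b p q : 0 < l -> chord (sim l b p) (sim l b q) = chord p q.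
Proof.
move=> l0; rewrite /chord {1 2}/sim opprD addrACA subrr addr0 -scalerBr.
rewrite eipZl eipZr /= !addr0 /GRing.scale /= mulrACA mulrA invfM mulrACA.
by rewrite divff ?mul1r // mulf_neq0 // gt_eqF.
Qed.

(** Inversion divides |p - q|^2 by |p|^2 |q|^2, and the two heights by |p|^2 and |q|^2. *)
Lemma chord_inversion p q : 0 < p.2 -> 0 < q.2 ->
  chord (inversion p) (inversion q) = chord p q.
Proof.
move=> p0 q0; rewrite /chord /inversion.
rewrite !(eipDl, eipDr, eipNl, eipNr, eipZl, eipZr) (eipC q p) /=.
have : [/\ eip p p != 0, eip q q != 0, p.2 != 0 & q.2 != 0].
  by rewrite !gt_eqF ?eip_gt0.
rewrite /GRing.scale /= => -[? ? ? ?]; field.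
by do !(apply/andP; split).
Qed.

Lemma chord_vertical x (y z : R) : chord (x, y) (x, z) = (y - z) ^+ 2 / (y * z).
Proof.
rewrite /chord /eip /= big1 ?add0r -?expr2 // => i _.
by rewrite !mxE subrr mul0r.
Qed.

Lemma chord_same_fst p q : p.1 = q.1 -> chord p q = (p.2 - q.2) ^+ 2 / (p.2 * q.2).
Proof. by case: p q => [x y] [x' z] /= ->; exact: chord_vertical. Qed.

(** * Height along the image of a vertical geodesic *)

Section Vertical.
Variables (f : V -> V) (x : 'rV[R]_d).
Hypothesis fi : local_isometry f.
Let F (t : R) : R := (f (x, t)).2.
Let dF (t : R) : R := ('d f (x, t) (0, 1)).2.

Lemma local_isometry_height_derive (t : R) : 0 < t -> is_derive t 1 F (dF t).
Proof.
case: fi => fH fd fm t0.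
have dv : is_diff t (fun s : R => (x, s)) (fun s => (0, s)).
  by have := is_diff_pair (is_diff_cst x t) (is_diff_id t).
have dfx : is_diff (x, t) f ('d f (x, t)) by apply: differentiableP; exact: fd.
have lsnd : linear (snd : V -> R) by [].
pose sndL : {linear V -> R} := HB.pack (snd : V -> R) (GRing.isLinear.Build _ _ _ _ _ lsnd).
have dsnd : is_diff (f (x, t)) (snd : V -> R) snd.
  have sc : continuous sndL by move=> q; exact: cvg_snd.
  apply: DiffDef.
    have := @linear_differentiable _ _ _ sndL (f (x, t)) sc.
    exact.
  have := @diff_lin _ _ _ sndL (f (x, t)) sc. exact.
have dFt : is_diff t F (fun s => ('d f (x, t) (0, s)).2).
  exact: (is_diff_comp (is_diff_comp dv dfx) dsnd).
apply: DeriveDef; first by apply: diff_derivable; exact: ex_diff.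
by rewrite deriveE ?diff_val //; exact: ex_diff.
Qed.

(** The vertical unit vector at [(x, t)] has hyperbolic length 1/t. Its image has the same length,
    which is at least |dF t| / F t. *)
Lemma local_isometry_height_bound (t : R) : 0 < t -> - F t <= dF t * t <= F t.
Proof.
case: fi => fH fd fm t0.
have := fm (x, t) (0, 1) (0, 1) t0; rewrite !hyp_metricE.
have Ft : 0 < F t by exact: (fH (x, t)).
rewrite {2}/eip /= big1 ?add0r ?mulr1; last by move=> i _; rewrite !mxE mul0r.
move/(congr1 ( *%R^~ (F t ^+ 2))); rewrite divfK ?sqrf_eq0 ?gt_eqF //.
have : dF t ^+ 2 <= eip ('d f (x, t) (0, 1)) ('d f (x, t) (0, 1)).
  rewrite /eip -expr2 lerDr; apply: sumr_ge0 => i _.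
  by rewrite -expr2 sqr_ge0.
move=> /[swap] ->; rewrite mulrC mul1r ler_pdivlMr ?exprn_gt0 // -exprMn.
by move=> h; rewrite -ler_norml -[F t]gtr0_norm // -ler_sqr ?nnegrE // !real_normK ?num_real.
Qed.

(** The bound on the derivative makes [F s / s] nonincreasing and [F s * s] nondecreasing: log F is
    1-Lipschitz in log s. *)
Lemma local_isometry_height (y z : R) : 0 < y -> y <= z ->
  F z * y <= F y * z /\ F y * y <= F z * z.
Proof.
move=> y0 yz.
have pos (t : R) : t \in `[y, z]%R -> 0 < t.
  by rewrite in_itv /= => /andP[yt _]; exact: lt_le_trans yt.
have pos' (t : R) : t \in `]y, z[%R -> 0 < t.
  by move=> /subset_itv_oo_cc; exact: pos.
have dI (t : R) : 0 < t -> is_derive t 1 (fun s : R => F s / s : R) (dF t / t - F t / t ^+ 2).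
  move=> t0; have t0' : t != 0 by rewrite gt_eqF.
  have h1 := local_isometry_height_derive t0.
  have h2 : is_derive t 1 (fun s : R => s^-1) (- t ^- 2 *: 1).
    apply: DeriveDef.
      by apply: (@derivableV _ _ (@id R)) => //; exact: derivable_id.
    by rewrite (@deriveV _ _ (@id R)) ?derive_id //; exact: derivable_id.
  apply: (is_derive_eq (is_deriveM h1 h2)).
  by rewrite /GRing.scale /=; field.
have dM (t : R) : 0 < t -> is_derive t 1 (fun s : R => F s * s : R) (dF t * t + F t).
  move=> t0; have h1 := local_isometry_height_derive t0.
  apply: (is_derive_eq (is_deriveM h1 (is_derive_id t (1 : R)))).
  by rewrite /GRing.scale /=; ring.
have c1 : {within `[y, z], continuous (fun s : R => F s / s : R)}.
  by apply: derivable_within_continuous => t /pos /dI [].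
have c2 : {within `[y, z], continuous (fun s : R => F s * s : R)}.
  by apply: derivable_within_continuous => t /pos /dM [].
have yI : y \in `[y, z]%R by rewrite in_itv /= lexx.
have zI : z \in `[y, z]%R by rewrite in_itv /= lexx andbT.
have z0 : 0 < z by exact: lt_le_trans yz.
split; last first.
  apply: (ger0_derive1_le_cc _ _ c2 yI zI yz) => t /pos' t0.
    by case: (dM _ t0).
  rewrite derive1E; case: (dM _ t0) => _ ->.
  by have /andP[? _] := local_isometry_height_bound t0; lra.
rewrite -ler_pdivrMr // mulrAC -ler_pdivlMr //.
apply: (ler0_derive1_le_cc _ _ c1 zI yI yz) => t /pos' t0.
  by case: (dI _ t0).
rewrite derive1E; case: (dI _ t0) => _ ->.
have /andP[_ h] := local_isometry_height_bound t0.
have -> : dF t / t - F t / t ^+ 2 = (dF t * t - F t) / t ^+ 2.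
  by field; rewrite gt_eqF.
by rewrite pmulr_lle0 ?invr_gt0 ?exprn_gt0 // subr_le0.
Qed.

Lemma chord_le_vertical_le (y z : R) : 0 < y -> y <= z ->
  (f (x, y)).1 = (f (x, z)).1 -> chord (f (x, y)) (f (x, z)) <= chord (x, y) (x, z).
Proof.
move=> y0 yz e; rewrite (chord_same_fst e) chord_vertical.
have z0 : 0 < z by exact: lt_le_trans yz.
have [h1 h2] := local_isometry_height y0 yz.
case: fi => fH _ _.
have F1 : 0 < F y by exact: (fH (x, y)).
have F2 : 0 < F z by exact: (fH (x, z)).
rewrite -/(F y) -/(F z) ler_pdivrMr ?mulr_gt0 // mulrAC ler_pdivlMr ?mulr_gt0 //.
(* Expanded, this is yz (F y^2 + F z^2) <= F y F z (y^2 + z^2), which is the goal up to equal cross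
   terms. *)
have : 0 <= (F y * z - F z * y) * (F z * z - F y * y) by rewrite mulr_ge0 // subr_ge0.
by lra.
Qed.
End Vertical.

Lemma chord_le_vertical f p q : local_isometry f -> 0 < p.2 -> 0 < q.2 ->
  p.1 = q.1 -> (f p).1 = (f q).1 -> chord (f p) (f q) <= chord p q.
Proof.
case: p q => [x y] [x' z] /= fi y0 z0 <- e.
have [yz|/ltW zy] := leP y z; first exact: chord_le_vertical_le.
by rewrite chordC (chordC (x, y)); apply: chord_le_vertical_le.
Qed.

(* The isometry is an inversion centred at an end of the geodesic semicircle
   through the two points; s below parametrizes this end on the line p.1, q.1. *)
Lemma make_vertical (p q : V) : 0 < p.2 -> 0 < q.2 -> exists h,
  [/\ local_isometry h,
      (forall r s : V, 0 < r.2 -> 0 < s.2 -> chord (h r) (h s) = chord r s),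
      (exists k, [/\ local_isometry k & forall r : V, 0 < r.2 -> k (h r) = r]) &
      (h p).1 = (h q).1].
Proof.
move=> p0 q0.
have [e|w0] := eqVneq p.1 q.1.
  exists (sim 1 0); split=> [|r s _ _||].
  - exact: local_isometry_sim.
  - exact: chord_sim.
  - exists (sim 1 0); split=> [|r _]; first exact: local_isometry_sim.
    by rewrite /sim -[(0, 0)]/(0 : V) !addr0 !scale1r.
  - by rewrite /= e.
pose w := q.1 - p.1.
pose l2 := \sum_(i < d) w ord0 i * w ord0 i.
have l2_gt0 : 0 < l2.
  rewrite lt0r; apply/andP; split; last first.
    by apply: sumr_ge0 => i _; rewrite -expr2 sqr_ge0.
  apply: contra w0 => /eqP h; rewrite eq_sym -subr_eq0; apply/eqP/rowP => i.
  have /(_ i isT)/eqP : forall i, true -> w ord0 i * w ord0 i = 0.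
    by apply: psumr_eq0P => // j _; rewrite -expr2 sqr_ge0.
  by rewrite mulf_eq0 orbb => /eqP ->; rewrite mxE.
(* After inversion centred at [p.1 + s *: w], the horizontal parts agree exactly when [s] solves the
   quadratic equation [sP]; [D] is its discriminant. *)
pose B := l2 + q.2 ^+ 2 - p.2 ^+ 2.
pose D := B ^+ 2 + 4 * l2 * p.2 ^+ 2.
have D0 : 0 <= D by rewrite addr_ge0 ?sqr_ge0 // !mulr_ge0 ?sqr_ge0 // ltW.
pose s := (B + Num.sqrt D) / (2 * l2).
have sP : s * (1 - s) * l2 + s * q.2 ^+ 2 + (1 - s) * p.2 ^+ 2 = 0.
  have : (2 * l2 * s - B) ^+ 2 = D.
    by rewrite /s mulrC divfK ?mulf_neq0 ?gt_eqF // addrC addKr sqr_sqrtr.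
  rewrite /D /B => e; apply: (@mulfI _ (4 * l2)); first by rewrite mulf_neq0 ?gt_eqF.
  by rewrite mulr0; lra.
pose a := p.1 + s *: w.
have sim_inv (b : 'rV[R]_d) (r : V) : sim 1 b (sim 1 (- b) r) = r.
  by rewrite /sim !scale1r -addrA -[_ + (b, 0)]/(- b + b, 0 + 0) addNr addr0 -[(0,0)]/(0 : V) addr0.
have simH (b : 'rV[R]_d) (r : V) : 0 < r.2 -> 0 < (sim 1 b r).2.
  by case: (local_isometry_sim b (ltr01 : 0 < (1 : R))) => + _ _; apply.
have invK (r : V) : 0 < r.2 -> inversion (inversion r) = r.
  move=> r0; rewrite {1}/inversion {3}/inversion scalerA.
  rewrite /inversion eipZl eipZr !invfM !invrK.
  by rewrite -[RHS]scale1r; congr (_ *: _); field; rewrite gt_eqF ?eip_gt0.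
exists (@inversion R d \o sim 1 (- a)); split.
- apply: local_isometry_comp; last exact: local_isometry_inversion.
  exact: local_isometry_sim.
- by move=> r t r0 t0 /=; rewrite chord_inversion ?chord_sim //; exact: simH.
- exists (sim 1 a \o @inversion R d); split=> [|r r0 /=].
    apply: local_isometry_comp; first exact: local_isometry_inversion.
    exact: local_isometry_sim.
  by rewrite invK ?sim_inv //; exact: simH.
- have pE : sim 1 (- a) p = (- s *: w, p.2).
    apply/pair_equal_spec; split; last by rewrite /= addr0 /GRing.scale /= mul1r.
    by rewrite /= scale1r /a opprD addNKr scaleNr.
  have qE : sim 1 (- a) q = ((1 - s) *: w, q.2).
    apply/pair_equal_spec; split; last by rewrite /= addr0 /GRing.scale /= mul1r.
    by rewrite /= scale1r /a opprD addrA scalerBl scale1r.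
  have eE (c y : R) : eip (c *: w, y) (c *: w, y) = c ^+ 2 * l2 + y ^+ 2.
    rewrite /eip /= -expr2 mulr_sumr; congr (_ + _); apply: eq_bigr => i _.
    by rewrite !mxE; ring.
  rewrite -[LHS]/((inversion (sim 1 (- a) p)).1) -[RHS]/((inversion (sim 1 (- a) q)).1).
  rewrite pE qE /inversion !eE /= !scalerA; congr (_ *: _).
  have n1 : (- s) ^+ 2 * l2 + p.2 ^+ 2 != 0.
    by rewrite gt_eqF // ltr_wpDl ?exprn_gt0 // mulr_ge0 ?sqr_ge0 // ltW.
  have n2 : (1 - s) ^+ 2 * l2 + q.2 ^+ 2 != 0.
    by rewrite gt_eqF // ltr_wpDl ?exprn_gt0 // mulr_ge0 ?sqr_ge0 // ltW.
  rewrite [LHS]mulrC [RHS]mulrC; apply/eqP; rewrite eqr_div //; apply/eqP.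
  by move: sP; lra.
Qed.

(** Isometries that preserve [chord], one before [f] and one after, put both the pair [p], [q] and
    the pair of images on vertical lines, where the bound is known. *)
Lemma local_isometry_chord_le f p q : local_isometry f -> 0 < p.2 -> 0 < q.2 ->
  chord (f p) (f q) <= chord p q.
Proof.
move=> fi p0 q0.
have [h [hi hc [k [ki hk]] hpq]] := make_vertical p0 q0.
have fH : forall r : V, 0 < r.2 -> 0 < (f r).2 by case: fi.
have hH : forall r : V, 0 < r.2 -> 0 < (h r).2 by case: hi.
have [h' [h'i h'c _ h'pq]] := make_vertical (fH _ p0) (fH _ q0).
have gi := local_isometry_comp (local_isometry_comp ki fi) h'i.
have key := @chord_le_vertical _ (h p) (h q) gi (hH _ p0) (hH _ q0) hpq.
move: key; rewrite /comp (hk _ p0) (hk _ q0) => /(_ h'pq).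
by rewrite (hc p q p0 q0) (h'c _ _ (fH _ p0) (fH _ q0)).
Qed.

End LocalIsometries.

(** * Rigidity of isometries *)

Section Rigidity.
Variables (R : realType) (d : nat).
Local Notation V := ('rV[R]_d * R)%type.

Lemma nbhs_halfspace (p : V) : 0 < p.2 -> \forall q \near p, 0 < (q : V).2.
Proof.
move=> p0; have c : (snd : V -> R) @ p --> p.2 by exact: cvg_snd.
exact: (@cvgr_gt _ _ (nbhs p) _ _ _ c 0 p0).
Qed.

Lemma near_eq_diff (f g : V -> V) (p u : V) :
  differentiable f p -> differentiable g p ->
  (\forall q \near p, f q = g q) -> 'd f p u = 'd g p u.
Proof.
move=> fd gd fg.
have e1 := deriveE u fd.
have e2 := deriveE u gd.
have e3 := near_eq_derive u fg.
exact: etrans (esym e1) (etrans e3 e2).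
Qed.

(** The half-space is open, so [f \o g] is the identity near [p] and ['d g p] is a right inverse of
    ['d f (g p)]; the metric identity for [f] then transfers to [g]. *)
Lemma local_isometry_inverse (f g : V -> V) :
  local_isometry f -> (forall p : V, 0 < p.2 -> 0 < (g p).2) ->
  (forall p : V, 0 < p.2 -> f (g p) = p) ->
  (forall p : V, 0 < p.2 -> differentiable g p) -> local_isometry g.
Proof.
move=> [fH fd fm] gH fg gd; split; [exact: gH|exact: gd|move=> p u v p0].
have gd0 := gd p p0.
have fd0 := fd _ (gH p p0).
have cE := diff_comp gd0 fd0.
have fgd := differentiable_comp gd0 fd0.
have ie : \forall q \near p, (f \o g) q = id q.
  by near=> q; apply: fg; near: q; exact: nbhs_halfspace.
have iE w := near_eq_diff w fgd (@ex_diff _ _ _ _ _ _ _ (is_diff_id p)) ie.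
have inv w : 'd f (g p) ('d g p w) = w.
  have e1 := congr1 (fun h : V -> V => h w) cE.
  have e2 := congr1 (fun h : V -> V => h w) (@diff_val _ _ _ _ _ _ _ (is_diff_id p)).
  exact: etrans (esym e1) (etrans (iE w) e2).
have gp0 := gH p p0.
have k := fm (g p) ('d g p u) ('d g p v) gp0.
have e1 := inv u; have e2 := inv v; have e3 := fg p p0.
rewrite e3 in k.
by transitivity (hyp_metric p ('d f (g p) ('d g p u)) ('d f (g p) ('d g p v)));
  [rewrite -k | congr hyp_metric].
Unshelve. all: by end_near. Qed.

Lemma hyp_isometry_local (f : V -> V) : hyp_isometry f -> local_isometry f.
Proof. by move=> [[g [[fH _] _ [fd _]]] fm]; split; [exact: fH|exact: fd|exact: fm]. Qed.

Lemma hyp_isometry_inv (f : V -> V) : hyp_isometry f -> exists g,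
  [/\ local_isometry g, forall p : V, 0 < p.2 -> g (f p) = p &
      forall p : V, 0 < p.2 -> f (g p) = p].
Proof.
move=> fi; have fl := hyp_isometry_local fi.
case: fi => [[g [[fH gH] [gf fg] [fd gd]]] fm]; exists g.
by split; [exact: local_isometry_inverse fl gH fg gd|exact: gf|exact: fg].
Qed.

Lemma hyp_isometry_gt0 (f : V -> V) (p : V) :
  hyp_isometry f -> 0 < p.2 -> 0 < (f p).2.
Proof. by move=> /hyp_isometry_local[fH _ _]; exact: fH. Qed.

(** Both [f] and its inverse are contractions. *)
Lemma hyp_isometry_chord (f : V -> V) (p q : V) : hyp_isometry f ->
  0 < p.2 -> 0 < q.2 -> chord (f p) (f q) = chord p q.
Proof.
move=> fi p0 q0; have [g [gl gf fg]] := hyp_isometry_inv fi.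
apply: le_anti; rewrite (local_isometry_chord_le (hyp_isometry_local fi)) //=.
rewrite -{1}(gf _ p0) -{1}(gf _ q0).
by apply: local_isometry_chord_le => //; exact: hyp_isometry_gt0.
Qed.

Lemma hyp_isometry_sim l (b : 'rV[R]_d) : 0 < l -> hyp_isometry (sim l b).
Proof.
move=> l0; have [simH simd simm] := local_isometry_sim b l0.
have li0 : 0 < l^-1 by rewrite invr_gt0.
have [simH' simd' _] := local_isometry_sim (- (l^-1 *: b)) li0.
have l_neq0 : l != 0 by rewrite gt_eqF.
split; last exact: simm.
exists (sim l^-1 (- (l^-1 *: b))); split; split=> // p p0.
- rewrite /sim scalerDr scalerA mulVf // scale1r -addrA.
  rewrite -[l^-1 *: (b, 0) + _]/(l^-1 *: b - l^-1 *: b, l^-1 * 0 + 0).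
  by rewrite subrr mulr0 addr0 -[(0, 0)]/(0 : V) addr0.
- rewrite /sim scalerDr scalerA divff // scale1r -addrA.
  rewrite -[l *: (_, 0) + _]/(l *: (- (l^-1 *: b)) + b, l * 0 + 0).
  by rewrite scalerN scalerA divff // scale1r addNr mulr0 addr0 -[(0, 0)]/(0 : V) addr0.
Qed.

(* The base points span the space of the hyperboloid model, and each is a bottom
   corner of a tile of every tiling below. *)
Definition base_point (j : option (option 'I_d)) : V :=
  match j with
  | None => (0, 2^-1)
  | Some None => (0, 4^-1)
  | Some (Some i) => (delta_mx ord0 i, 2^-1)
  end.

Lemma base_point_gt0 j : 0 < (base_point j).2.
Proof. by case: j => [[i|]|] /=; rewrite invr_gt0. Qed.

(** The chords to the two base points above the origin determine the height and then |x|^2; each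
    other base point then gives one coordinate linearly. *)
Lemma chord_base_point_inj (p q : V) : 0 < p.2 -> 0 < q.2 ->
  (forall j, chord p (base_point j) = chord q (base_point j)) -> p = q.
Proof.
case: p q => [x y] [z t] /= y0 t0 h.
have e0 (w : 'rV[R]_d) (s r : R) : eip ((w, s) - (0, r)) ((w, s) - (0, r)) =
    \sum_(i < d) w ord0 i ^+ 2 + (s - r) ^+ 2.
  by rewrite /eip /= subr0 -expr2; congr (_ + _); apply: eq_bigr => i _.
have e1 (w : 'rV[R]_d) i (s r : R) :
    eip ((w, s) - (delta_mx ord0 i, r)) ((w, s) - (delta_mx ord0 i, r)) =
    \sum_(i < d) w ord0 i ^+ 2 - 2 * w ord0 i + 1 + (s - r) ^+ 2.
  rewrite /eip /= -expr2; congr (_ + _).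
  rewrite (bigD1 i) //= [in RHS](bigD1 i) //= !mxE !eqxx /=.
  under eq_bigr => j ji do rewrite !mxE (negbTE ji) andbF subr0 -expr2.
  by ring.
have half0 : (0 : R) < 2^-1 by rewrite invr_gt0.
have quarter0 : (0 : R) < 4^-1 by rewrite invr_gt0.
have e (a b c : R) : 0 < c -> a / (y * c) = b / (t * c) -> a * t = b * y.
  move=> c0; have sc0 : y * c != 0 by rewrite gt_eqF ?mulr_gt0.
  have rc0 : t * c != 0 by rewrite gt_eqF ?mulr_gt0.
  move=> /eqP; rewrite eqr_div // => /eqP.
  by rewrite !mulrA; apply: mulIf; rewrite gt_eqF.
have := h (Some None); rewrite /chord /base_point !e0 => /(e _ _ _ quarter0) h1.
have := h None; rewrite /chord /base_point !e0 => /(e _ _ _ half0) h2.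
have hyt : y = t by move: h1 h2; lra.
have t_neq0 : t != 0 by rewrite gt_eqF.
have hS : \sum_(i < d) x ord0 i ^+ 2 = \sum_(i < d) z ord0 i ^+ 2.
  by move: h1; rewrite hyt => /(mulIf t_neq0); lra.
rewrite hyt; congr pair; apply/rowP => i.
have := h (Some (Some i)); rewrite /chord /base_point !e1 => /(e _ _ _ half0).
by rewrite hyt hS => /(mulIf t_neq0); lra.
Qed.

(** With [g] inverse to [f'], the points [g (f p)] and [p] have the same chords to all base
    points. *)
Lemma hyp_isometry_eq (f f' : V -> V) : hyp_isometry f -> hyp_isometry f' ->
  (forall j, f (base_point j) = f' (base_point j)) ->
  forall p : V, 0 < p.2 -> f p = f' p.
Proof.
move=> fi f'i h p p0.
have [g [gl gf' f'g]] := hyp_isometry_inv f'i.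
have fp0 := hyp_isometry_gt0 fi p0.
have gp0 : 0 < (g (f p)).2 by case: gl => + _ _; apply.
rewrite -(f'g (f p)) //; congr f'.
apply: chord_base_point_inj => // j.
have b0 := base_point_gt0 j.
by rewrite -(hyp_isometry_chord f'i) // f'g // -h hyp_isometry_chord.
Qed.

(** * Bottom corners and the diameter of the prototile *)

Definition corner (s : 'I_d -> bool) : 'rV[R]_d :=
  \row_i (if s i then 2^-1 else - 2^-1).

Lemma prototile_gt0 (p : V) : prototile p -> 0 < p.2.
Proof. by move=> [_ /andP[h _]]; apply: lt_le_trans h; rewrite invr_gt0. Qed.

Lemma prototile_corner s (y : R) : 2^-1 <= y <= 1 -> @prototile R d (corner s, y).
Proof. by move=> hy; split=> //= i; rewrite mxE; case: (s i); lra. Qed.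

Lemma chord_corner s :
  chord (corner s, 2^-1) (corner (fun i => ~~ s i), 2^-1) = 4 * d%:R :> R.
Proof.
rewrite /chord /eip /= subrr mulr0 addr0.
rewrite (eq_bigr (fun=> 1)).
  by rewrite sumr_const card_ord; field.
by move=> i _; rewrite !mxE; case: (s i) => /=; field.
Qed.

Hypothesis d_gt0 : (0 < d)%N.

(* 4 d is the maximum of chord on the prototile. *)
Lemma prototile_diameter (p q : V) : prototile p -> prototile q ->
  4 * d%:R <= chord p q -> exists s, p = (corner s, 2^-1).
Proof.
case: p q => [x y] [z t] [/= hx /andP[y1 y2]] [/= hz /andP[t1 t2]].
have y0 : 0 < y by lra.
have t0 : 0 < t by lra.
have d1 : 1 <= d%:R :> R by rewrite ler1n.
rewrite /chord /eip /= ler_pdivlMr ?mulr_gt0 //.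
have le1 i : true -> 0 <= 1 - (x - z) ord0 i * (x - z) ord0 i.
  move=> _; rewrite !mxE; have := hx i; have := hz i.
  move=> /andP[z1 z2] /andP[x1 x2]; nra.
set S := \sum_(_ < _) _ => hS.
have sumE : \sum_(i < d) (1 - (x - z) ord0 i * (x - z) ord0 i) = d%:R - S.
  by rewrite sumrB sumr_const card_ord.
have S1 : 0 <= d%:R - S by rewrite -sumE; apply: sumr_ge0 => i; exact: le1.
(* As S <= d, the hypothesis yields d (4yt - 1) <= (y - t)^2, hence 4yt - 1 <= (y - t)^2 because d
   >= 1 and 4yt >= 1. For heights in [1/2, 1] this holds only at y = t = 1/2. *)
have k1 : 0 <= (d%:R - 1) * (4 * y * t - 1).
  by apply: mulr_ge0; [lra|nra].
have k2 : 4 * y * t - 1 <= (y - t) ^+ 2 by nra.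
have k3 : 0 <= (2^-1 - (y - 2^-1)) * (t - 2^-1) by apply: mulr_ge0; lra.
have k4 : 0 <= (2^-1 - (t - 2^-1)) * (y - 2^-1) by apply: mulr_ge0; lra.
have yE : y = 2^-1 by nra.
have tE : t = 2^-1 by nra.
have S2 : d%:R - S = 0.
  by apply: le_anti; rewrite S1 andbT; move: hS; rewrite yE tE; lra.
(* The nonnegative terms 1 - (x_i - z_i)^2 now sum to 0, so every difference is 1 or -1 and [x] is a
   vertex of the cube. *)
exists (fun i => 0 < x ord0 i); rewrite yE; congr pair; apply/rowP => i.
have := psumr_eq0P le1; rewrite sumE S2 => /(_ erefl i isT).
rewrite !mxE; have := hx i; have := hz i.
move=> /andP[z1 z2] /andP[x1 x2] hi.
case: ltP => x0.
  by apply/eqP; rewrite eq_le x2 /=; nra.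
by apply/eqP; rewrite eq_le x1 andbT; nra.
Qed.

(** A bottom corner and its opposite are at chord 4 d. Their images are at the same chord in the
    second copy, so they realize its diameter. *)
Lemma hyp_isometry_corner f l b l' b' s : hyp_isometry f -> 0 < l -> 0 < l' ->
  f @` (sim l b @` @prototile R d) `<=` sim l' b' @` @prototile R d ->
  exists s', f (sim l b (corner s, 2^-1)) = sim l' b' (corner s', 2^-1).
Proof.
move=> fi l0 l'0 sub.
have im s0 : exists2 p, prototile p & sim l' b' p = f (sim l b (corner s0, 2^-1)).
  have [p Bp e] : (sim l' b' @` @prototile R d) (f (sim l b (corner s0, 2^-1))).
    apply: sub; exists (sim l b (corner s0, 2^-1)) => //.
    exists (corner s0, 2^-1) => //.
    by apply: prototile_corner; rewrite lexx /=; lra.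
  by exists p.
have [p Bp ep] := im s; have [q Bq eq] := im (fun i => ~~ s i).
have [s' e] : exists s, p = (corner s, 2^-1).
  apply: (prototile_diameter Bp Bq).
  rewrite -(chord_sim b' p q l'0) ep eq (hyp_isometry_chord fi).
  - by rewrite (chord_sim _ _ _ l0) chord_corner.
  - by rewrite /= addr0 mulr_gt0 // invr_gt0.
  - by rewrite /= addr0 mulr_gt0 // invr_gt0.
by exists s'; rewrite -ep e.
Qed.

End Rigidity.

(** * Orientation of the vertical edges in dimension 1 *)

Section OrientedEdges.
Variable R : realType.
Local Notation V := ('rV[R]_1 * R)%type.

Lemma chord1 (p q : V) : chord p q =
  ((p.1 ord0 ord0 - q.1 ord0 ord0) ^+ 2 + (p.2 - q.2) ^+ 2) / (p.2 * q.2).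
Proof. by rewrite /chord /eip big_ord_recl big_ord0 addr0 /= !mxE -!expr2. Qed.

Lemma corner1 s : @corner R 1 s ord0 ord0 = if s ord0 then 2^-1 else - 2^-1.
Proof. by rewrite mxE. Qed.

Lemma rV1P (x y : 'rV[R]_1) : x ord0 ord0 = y ord0 ord0 -> x = y.
Proof. by move=> e; apply/rowP => i; rewrite !ord1. Qed.

(* A symmetry of the prototile cannot exchange the ends of a vertical edge: the
   reflection across the geodesic through the bottom corners sends (1/2, 1) to
   (1/5, 2/5). *)
Lemma hyp_isometry_cedge (f : V -> V) l b s : hyp_isometry f -> 0 < l ->
  f @` @prototile R 1 `<=` sim l b @` @prototile R 1 ->
  exists s', f (corner R s, 2^-1) = sim l b (corner R s', 2^-1) /\
             f (corner R s, 1) = sim l b (corner R s', 1).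
Proof.
move=> fi l0 sub.
have sub1 : f @` (sim 1 0 @` @prototile R 1) `<=` sim l b @` @prototile R 1.
  move=> _ [_ [p Bp <-] <-]; apply: sub; exists p => //.
  by rewrite /sim scale1r -[(0, 0)]/(0 : V) addr0.
have sim1 (p : V) : sim 1 0 p = p.
  by rewrite /sim scale1r -[(0, 0)]/(0 : V) addr0.
have cor s0 := @hyp_isometry_corner R 1 isT f 1 0 l b s0 fi ltr01 l0 sub1.
have [s1 e1] := cor s; have [s2 e2] := cor (fun i => ~~ s i).
rewrite !sim1 in e1 e2.
exists s1; split=> //.
have [p Bp e3] : (sim l b @` @prototile R 1) (f (corner R s, 1)).
  by apply: sub; exists (corner R s, 1) => //; apply: prototile_corner; apply/andP; split; lra.
have half0 : (0 : R) < 2^-1 by rewrite invr_gt0.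
have h12 := chord_corner R s; rewrite -(hyp_isometry_chord fi) // e1 e2 chord_sim // in h12.
have h1 : chord (f (corner R s, 1)) (f (corner R s, 2^-1)) = chord (corner R s, 1) (corner R s, 2^-1).
  by rewrite hyp_isometry_chord.
have h2 : chord (f (corner R s, 1)) (f (corner R (fun i => ~~ s i), 2^-1)) =
    chord (corner R s, 1) (corner R (fun i => ~~ s i), 2^-1).
  by rewrite hyp_isometry_chord.
have p0 := prototile_gt0 Bp.
rewrite -e3; congr sim.
move: h12 h1 h2; rewrite e1 e2 -e3 !chord_sim // !chord1 !corner1.
case: p Bp p0 {e3} => [x y] [/= hx /andP[y1 y2]] y0.
set u := x ord0 ord0.
move=> h12 h1 h2.
have k1 (a c : R) : a / (y * 2^-1) = c -> 2 * a = c * y.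
  by move=> <-; field; rewrite gt_eqF.
suff [ye ue] : y = 1 /\ u = if s1 ord0 then 2^-1 else - 2^-1.
  by congr pair => //; apply: rV1P; rewrite corner1.
have {h1}h1 := k1 _ _ h1; have {h2}h2 := k1 _ _ h2.
move: h12 h1 h2.
(* The chords to the two bottom corners leave only the heights 1 and 2/5, and 2/5 lies below the
   prototile. *)
have ye : y <> 1 -> 5 * y - 2 = 0 -> False by lra.
by case: (s ord0); case: (s1 ord0); case: (s2 ord0) => /=;
  rewrite ?subrr; move=> h12 h1 h2; try (exfalso; lra);
  (have key : (y - 1) * (5 * y - 2) = 0 by nra);
  (have y1e : y = 1 by move/eqP: key; rewrite mulf_eq0 => /orP[]/eqP; lra);
  split=> //; rewrite y1e in h1 h2; lra.
Qed.

(** The origins have heights l and l', and E lies in both tiles, so l = l'. Then [p'] is a point of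
    E at the height of [p], and its chord to [q] is too small unless it is vertically above [q]. *)
Lemma oriented_cedge_agree l b l' b' E (p q p' q' : V) : 0 < l -> 0 < l' ->
  oriented_cedge (sim l b @` @prototile R 1) E p q ->
  oriented_cedge (sim l' b' @` @prototile R 1) E p' q' -> p = p' /\ q = q'.
Proof.
move=> l0 l'0 [f [fi tE [s [EE pE qE]]]] [f' [f'i t'E [s' [E'E p'E q'E]]]].
have [s1 [e1 e2]] : exists s', f (corner R s, 2^-1) = sim l b (corner R s', 2^-1) /\
             f (corner R s, 1) = sim l b (corner R s', 1).
  by apply: hyp_isometry_cedge => //; rewrite -tE.
have [s1' [e1' e2']] : exists s1, f' (corner R s', 2^-1) = sim l' b' (corner R s1, 2^-1) /\
             f' (corner R s', 1) = sim l' b' (corner R s1, 1).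
  by apply: hyp_isometry_cedge => //; rewrite -t'E.
have hE r : E r -> l / 2 <= r.2 <= l.
  rewrite EE => -[[v y]] /= [-> hy] <-.
  have : (sim l b @` @prototile R 1) (f (corner R s, y)).
    by rewrite tE; exists (corner R s, y) => //; exact: prototile_corner.
  move=> [[x z] [_ /= /andP[z1 z2]] <-] /=; rewrite addr0 /GRing.scale /=.
  by apply/andP; split; nra.
have hE' r : E r -> l' / 2 <= r.2 <= l'.
  rewrite E'E => -[[v y]] /= [-> hy] <-.
  have : (sim l' b' @` @prototile R 1) (f' (corner R s', y)).
    by rewrite t'E; exists (corner R s', y) => //; exact: prototile_corner.
  move=> [[x z] [_ /= /andP[z1 z2]] <-] /=; rewrite addr0 /GRing.scale /=.
  by apply/andP; split; nra.
have Ep : E p by rewrite EE pE; exists (corner R s, 1) => //=; split=> //; apply/andP; split; lra.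
have Ep' : E p' by rewrite E'E p'E; exists (corner R s', 1) => //=; split=> //; apply/andP; split; lra.
rewrite -/(corner R s) e2 in pE; rewrite -/(corner R s) e1 in qE.
rewrite -/(corner R s') e2' in p'E; rewrite -/(corner R s') e1' in q'E.
have ll' : l = l'.
  have := hE _ Ep'; have := hE' _ Ep; rewrite pE p'E /= !addr0 /GRing.scale /= !mulr1.
  by move=> /andP[_ ?] /andP[_ ?]; apply: le_anti; apply/andP.
(* On a vertical edge of the prototile the chord to the bottom end is largest at the top, where it
   equals 1/2. *)
have : chord p' q <= 2^-1.
  move: Ep'; rewrite EE => -[[v y]] /= [-> /andP[y1 y2]] <-.
  have y0 : 0 < y by lra.
  rewrite qE -e1 hyp_isometry_chord //= ?invr_gt0 //.
  rewrite chord_vertical ler_pdivrMr; last by rewrite mulr_gt0 ?invr_gt0.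
  by nra.
rewrite chord1 pE qE p'E q'E /sim -ll' /= !mxE !addr0 /GRing.scale /= mulr1.
set u := l * _ + _; set u' := l * _ + _ => h.
have uu' : u = u'.
  move: h; rewrite ler_pdivrMr; last by rewrite !mulr_gt0 ?invr_gt0.
  move=> h; have {}h : (u - u') ^+ 2 <= 0 by nra.
  by apply/eqP; rewrite -subr_eq0 -sqrf_eq0 eq_le h sqr_ge0.
by split; congr pair; apply: rV1P; rewrite /= !mxE.
Qed.

End OrientedEdges.

(** * Adjacent tiles of a layered tiling *)

Section Cells.
Variables (R : realType) (d : nat).
Local Notation V := ('rV[R]_d * R)%type.

(** Carries the prototile onto the box with base o + 2^n (k + [0, 1]^d) and heights from 2^(n-1) to
    2^n; the summand 1/2 accounts for the centred cube. *)
Definition cell (n : int) (o : nat) (k : 'I_d -> int) : V -> V :=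
  sim (2 ^ n) (\row_i (o%:R + 2 ^ n * ((k i)%:~R + 2^-1))).

Definition cell_inv (n : int) (o : nat) (k : 'I_d -> int) (p : V) : V :=
  (\row_i ((p.1 ord0 i - o%:R) / 2 ^ n - (k i)%:~R - 2^-1), p.2 / 2 ^ n).

Lemma exp2z_gt0 (n : int) : 0 < (2 : R) ^ n.
Proof. by rewrite exprz_gt0. Qed.

Lemma cell_invK n o k p : cell_inv n o k (cell n o k p) = p.
Proof.
have n0 : (2 : R) ^ n != 0 by rewrite gt_eqF ?exp2z_gt0.
case: p => x y; congr pair; last by rewrite /= addr0 /GRing.scale /= mulrC mulKf.
by apply/rowP => i; rewrite !mxE; field.
Qed.

Lemma cellK n o k p : cell n o k (cell_inv n o k p) = p.
Proof.
have n0 : (2 : R) ^ n != 0 by rewrite gt_eqF ?exp2z_gt0.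
case: p => x y; congr pair; last by rewrite /= addr0 /GRing.scale /= mulrC divfK.
by apply/rowP => i; rewrite !mxE; field.
Qed.

Lemma cell_image n o k (A : set V) p : (cell n o k @` A) p <-> A (cell_inv n o k p).
Proof.
split=> [[q Aq <-]|Ap]; first by rewrite cell_invK.
by exists (cell_inv n o k p) => //; rewrite cellK.
Qed.

Lemma hyp_isometry_cell n o k : hyp_isometry (cell n o k).
Proof. exact/hyp_isometry_sim/exp2z_gt0. Qed.

Definition tile n o k : set V := cell n o k @` @prototile R d.

Lemma tile_is_tile n o k : is_tile (tile n o k).
Proof. by exists (cell n o k) => //; exact: hyp_isometry_cell. Qed.

Lemma tile_gt0 n o k p : tile n o k p -> 0 < p.2.
Proof.
move=> [q Bq <-]; apply: hyp_isometry_gt0; first exact: hyp_isometry_cell.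
exact: prototile_gt0 Bq.
Qed.

Lemma tile_face_cell n o k G (F : set V) : prototile_face G ->
  F = cell n o k @` G -> tile_face (tile n o k) F.
Proof.
by move=> GF ->; exists (cell n o k); split; [exact: hyp_isometry_cell| |exists G].
Qed.

Lemma cube_faceP (s : 'I_d -> option bool) (x : 'rV[R]_d) : cube_face s x <->
  forall i, match s i with
            | None => - 2^-1 <= x ord0 i <= 2^-1
            | Some b => x ord0 i = if b then 2^-1 else - 2^-1
            end.
Proof.
by split=> h i; have := h i; case: (s i) => [[]|];
  rewrite ?mxE.
Qed.

Lemma subcube_faceP sg (s : 'I_d -> option bool) (x : 'rV[R]_d) :
  subcube_face sg s x <->
  forall i, match s i with
            | None => (if sg i then 0 else - 2^-1) <= x ord0 i <= (if sg i then 2^-1 else 0)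
            | Some b => x ord0 i = if b then (if sg i then 2^-1 else 0)
                                   else (if sg i then 0 else - 2^-1)
            end.
Proof. by split=> h i; have := h i; case: (s i) => [[]|]; rewrite ?mxE. Qed.

(** In the coordinates of the first tile, the second is its translate by the integer vector [m].
    They meet when every |m i| <= 1, in the vertical face that fixes the coordinates with [m i]
    nonzero; there is one since [k] and [k'] differ. Exchanging the tiles gives the face of the
    other. *)
Lemma tile_same_layer n o k k' : k <> k' ->
  tile n o k `&` tile n o k' = set0 \/ tile_face (tile n o k) (tile n o k `&` tile n o k').
Proof.
move=> kk'; pose m i := k' i - k i.
have E (p : V) i : (cell_inv n o k' p).1 ord0 i = (cell_inv n o k p).1 ord0 i - (m i)%:~R.
  by rewrite !mxE /m intrB; ring.
have [small|/existsNP[i hi]] := pselect (forall i, -1 <= m i <= 1); last first.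
  left; apply/seteqP; split=> // p [/cell_image[/(_ i) h1 _] /cell_image[/(_ i)]].
  rewrite E; move: h1; set u := (cell_inv n o k p).1 ord0 i.
  move=> /andP[u1 u2] /andP[u3 u4] _; apply: hi.
  have m1 : (m i)%:~R < (2%:~R : R) by lra.
  have m2 : ((-2)%:~R : R) < (m i)%:~R by lra.
  by move: m1 m2; rewrite !ltr_int; lia.
right; pose s i := if m i == 0 then None else Some (0 < m i).
have sd : (face_dim s < d)%N.
  rewrite /face_dim -[X in (_ < X)%N]card_ord; apply: proper_card.
  apply/properP; split; first exact/subset_predT.
  have [i ki] : exists i, k i <> k' i.
    by apply/existsNP => h; apply: kk'; apply/funext.
  exists i => //; rewrite inE /s; case: ifP => //; rewrite /m subr_eq0 => /eqP e.
  by case: ki; rewrite e.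
apply: tile_face_cell (PFc R sd) _; apply/seteqP.
have key (u : R) (j : int) : -1 <= j <= 1 ->
    ((- 2^-1 <= u <= 2^-1) && (- 2^-1 <= u - j%:~R <= 2^-1) <->
    match (if j == 0 then None else Some (0 < j)) with
    | None => (- 2^-1 <= u) && (u <= 2^-1)
    | Some b => u = (if b then 2^-1 else - 2^-1) end).
  move=> hj; have : j \in [:: -1; 0; 1] by rewrite !inE; lia.
  rewrite !inE => /or3P[] /eqP -> /=.
  - by split=> [/andP[/andP[? ?] /andP[? ?]]|->]; [lra|apply/andP; split; apply/andP; split; lra].
  - by rewrite subr0 andbb.
  - by split=> [/andP[/andP[? ?] /andP[? ?]]|->]; [lra|apply/andP; split; apply/andP; split; lra].
split=> p.
  move=> [/cell_image[h1 h2] /cell_image[h3 _]]; apply/cell_image; split=> //; apply/cube_faceP => i.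
  have := h3 i; rewrite E => h3'; have := (key ((cell_inv n o k p).1 ord0 i) _ (small i)).1.
  by rewrite (h1 i) h3' => /(_ isT).
move=> /cell_image[/cube_faceP h1 h2].
have h3 i : (- 2^-1 <= (cell_inv n o k p).1 ord0 i <= 2^-1) &&
    (- 2^-1 <= (cell_inv n o k p).1 ord0 i - (m i)%:~R <= 2^-1).
  exact/(key _ _ (small i))/h1.
split; apply/cell_image; split=> // i; have /andP[h4 h5] := h3 i => //.
by rewrite E.
Qed.

(* The integer k - e - 2 k', one of -1, 0, 1, 2 when the cubes meet, locates the
   lower cube relative to the upper one. *)
Lemma cell_inv_next n o (e : bool) o' k k' i (p : V) :
  (o' %:R = o%:R + e%:R * 2 ^ n :> R) ->
  (cell_inv (n + 1) o' k' p).1 ord0 i =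
  ((cell_inv n o k p).1 ord0 i + (k i - e%:Z - 2 * k' i)%:~R - 2^-1) / 2.
Proof.
move=> oE; rewrite !mxE oE !intrB intrM.
have n0 : (2 : R) ^ n != 0 by rewrite gt_eqF ?exp2z_gt0.
rewrite exprzDr ?unitfE // expr1z.
have -> : (e%:Z)%:~R = e%:R :> R by [].
by field.
Qed.

Lemma cell_inv_next_height n o o' k k' (p : V) :
  (cell_inv (n + 1) o' k' p).2 = (cell_inv n o k p).2 / 2.
Proof. by rewrite /= exprzDr ?unitfE // expr1z invfM mulrA. Qed.

(** The cubes on top of layer n subdivide the bottoms of layer n + 1. In coordinate i, [m i] equal
    to 0 or 1 selects a half of the upper cube; for -1 and 2 the cubes only touch, which fixes the
    coordinate. *)
Lemma tile_next_layer n o (e : bool) o' k k' :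
  (o' %:R = o%:R + e%:R * 2 ^ n :> R) ->
  tile n o k `&` tile (n + 1) o' k' = set0 \/
  (tile_face (tile n o k) (tile n o k `&` tile (n + 1) o' k') /\
   tile_face (tile (n + 1) o' k') (tile n o k `&` tile (n + 1) o' k')).
Proof.
move=> oE; pose m i := k i - e%:Z - 2 * k' i.
have E (p : V) i : (cell_inv (n + 1) o' k' p).1 ord0 i =
    ((cell_inv n o k p).1 ord0 i + (m i)%:~R - 2^-1) / 2 by exact: cell_inv_next.
have H (p : V) : (cell_inv (n + 1) o' k' p).2 = (cell_inv n o k p).2 / 2.
  exact: cell_inv_next_height.
have [small|/existsNP[i hi]] := pselect (forall i, -1 <= m i <= 2); last first.
  left; apply/seteqP; split=> // p [/cell_image[/(_ i) h1 _] /cell_image[/(_ i)]].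
  rewrite E; move: h1; set u := (cell_inv n o k p).1 ord0 i.
  move=> /andP[u1 u2] /andP[u3 u4] _; apply: hi.
  have m1 : (m i)%:~R < (3%:~R : R) by lra.
  have m2 : ((-2)%:~R : R) < (m i)%:~R by lra.
  by move: m1 m2; rewrite !ltr_int; lia.
right.
have mcase i : m i \in [:: -1; 0; 1; 2] by rewrite !inE; have := small i; lia.
split.
  (* The intersection as a face of the top facet of the lower tile. *)
  pose s i := if m i == -1 then Some true else if m i == 2 then Some false else None.
  apply: tile_face_cell (PFa R s) _; apply/seteqP; split=> p.
    move=> [/cell_image[h1 h2] /cell_image[h3 h4]]; apply/cell_image.
    split; first (apply/cube_faceP => i).
      have := h3 i; have := h1 i; rewrite E /s.
      set u := (cell_inv n o k p).1 ord0 i => /andP[u1 u2] /andP[u3 u4].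
      by have := mcase i; rewrite !inE => /or4P[] /eqP e1; rewrite e1 /= -/u in u3 u4 *;
        rewrite ?u1 ?u2 //; lra.
    change ((cell_inv n o k p).2 = 1).
    by move: h2 h4; rewrite H => /andP[? ?] /andP[? ?]; lra.
  move=> /cell_image[/cube_faceP h1 h2].
  have h3 i : (- 2^-1 <= (cell_inv n o k p).1 ord0 i <= 2^-1) &&
    (- 2^-1 <= ((cell_inv n o k p).1 ord0 i + (m i)%:~R - 2^-1) / 2 <= 2^-1).
    have := h1 i; rewrite /s; set u := (cell_inv n o k p).1 ord0 i.
    have := mcase i; rewrite !inE => /or4P[] /eqP e1; rewrite e1 /= -/u.
    - by move=> ->; apply/andP; split; apply/andP; split; lra.
    - by move=> /andP[? ?]; apply/andP; split; apply/andP; split; lra.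
    - by move=> /andP[? ?]; apply/andP; split; apply/andP; split; lra.
    - by move=> ->; apply/andP; split; apply/andP; split; lra.
  have {}h2 : (cell_inv n o k p).2 = 1 by exact: h2.
  split; apply/cell_image; split=> [i|].
  - by have /andP[] := h3 i.
  - by rewrite h2; apply/andP; split; lra.
  - by rewrite E; have /andP[] := h3 i.
  - by rewrite H h2; apply/andP; split; lra.
(* The same set as a face of the bottom facet of the upper tile in the orthant [sg]. *)
pose sg i := 1 <= m i.
pose s i := if m i == -1 then Some false else if m i == 2 then Some true else None.
apply: tile_face_cell (PFb R sg s) _; apply/seteqP; split=> p.
  move=> [/cell_image[h1 h2] /cell_image[h3 h4]]; apply/cell_image.
  split; first (apply/subcube_faceP => i).
    have := h3 i; have := h1 i; rewrite /s /sg.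
    have := E p i; set u' := (cell_inv (n + 1) o' k' p).1 ord0 i.
    set u := (cell_inv n o k p).1 ord0 i => e2 /andP[u1 u2] /andP[u3 u4].
    by have := mcase i; rewrite !inE => /or4P[] /eqP e1; rewrite e1 /= ?e1 /= -/u' in e2 *;
      try apply/andP; try split; lra.
  change ((cell_inv (n + 1) o' k' p).2 = 2^-1).
  by move: h2 h4; rewrite H => /andP[? ?] /andP[? ?]; lra.
move=> /cell_image[/subcube_faceP h1 h2].
have h3 i : (- 2^-1 <= (cell_inv n o k p).1 ord0 i <= 2^-1) &&
    (- 2^-1 <= (cell_inv (n + 1) o' k' p).1 ord0 i <= 2^-1).
  have := h1 i; rewrite /s /sg; have := E p i.
  set u' := (cell_inv (n + 1) o' k' p).1 ord0 i; set u := (cell_inv n o k p).1 ord0 i.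
  have := mcase i; rewrite !inE => /or4P[] /eqP e1; rewrite e1 /= ?e1 /= -/u' => e2.
  - by move=> ?; apply/andP; split; apply/andP; split; lra.
  - by move=> /andP[? ?]; apply/andP; split; apply/andP; split; lra.
  - by move=> /andP[? ?]; apply/andP; split; apply/andP; split; lra.
  - by move=> ?; apply/andP; split; apply/andP; split; lra.
have {}h2 : (cell_inv n o k p).2 / 2 = 2^-1 by rewrite -H; exact: h2.
split; apply/cell_image; split=> [i|].
- by have /andP[] := h3 i.
- by apply/andP; split; lra.
- by have /andP[] := h3 i.
- by rewrite H h2; apply/andP; split; lra.
Qed.

(** * Separation of layers, disjoint interiors and covering *)

Lemma exp2z_le (n n' : int) : n <= n' -> (2 : R) ^ n <= 2 ^ n'.
Proof. by move=> h; rewrite ler_eXz2l // ltr1n. Qed.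

Lemma tile_height n o k p : tile n o k p -> 2 ^ n <= 2 * p.2 /\ p.2 <= 2 ^ n.
Proof.
move=> /cell_image[_ /=]; have n0 := exp2z_gt0 n.
by rewrite ler_pdivlMr // ler_pdivrMr // => /andP[? ?]; split; lra.
Qed.

Lemma tile_far_layers n o k n' o' k' : n + 1 < n' ->
  tile n o k `&` tile n' o' k' = set0.
Proof.
move=> nn'; apply/seteqP; split=> // p [/tile_height[_ h1] /tile_height[h2 _]].
have : (2 : R) ^ (n + 2) <= 2 ^ n' by apply: exp2z_le; lia.
rewrite exprzDr ?unitfE // -[2 ^ 2]/(2 ^+ 2).
by have := exp2z_gt0 n; lra.
Qed.

(** A small move along [v] stays in [A] but changes [phi]. The overlap of two tiles lies in a level
    set of such a [phi]. *)
Lemma interior_not_const (A : set V) (p v : V) (phi : V -> R) (c l : R) : 0 < l ->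
  nbhs p A -> (forall q, A q -> phi q = c) ->
  (forall s : R, phi (p + s *: v) = phi p + s * l) -> False.
Proof.
move=> l0 nA cA lin.
have c1 : (fun s : R => p + s *: v) @ (0 : R) --> p.
  rewrite -[X in _ --> X]addr0 -(scale0r v).
  by apply: cvgD; [exact: cvg_cst|apply: cvgZr_tmp; exact: cvg_id].
have /nbhs_ballP[e /= e0 he] := c1 _ nA.
have /cA : A (p + (e / 2) *: v).
  by apply: he; rewrite /ball /= sub0r normrN gtr0_norm ?divr_gt0 // ltr_pdivrMr // mulr2n mulrDr mulr1 ltrDl.
have /cA h0 := nbhs_singleton nA.
rewrite lin h0 => /eqP; rewrite -subr_eq0 addrAC subrr add0r mulf_eq0.
by rewrite !gt_eqF ?divr_gt0.
Qed.

Lemma interior_tile_same_layer n o k k' : k <> k' ->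
  interior (tile n o k) `&` interior (tile n o k') = set0.
Proof.
move=> kk'; apply/seteqP; split=> // p [h1 h2].
have [i ki] : exists i, k i <> k' i.
  by apply/existsNP => h; apply: kk'; apply/funext.
have nI : nbhs p (tile n o k `&` tile n o k') by exact: filterI.
pose phi (q : V) : R := (q.1 ord0 i - o%:R) / 2 ^ n.
(* In units of 2^n, coordinate i lies in [k i, k i + 1] and in [k' i, k' i + 1], so on the overlap
   it equals the larger left end. *)
pose c : R := if k i < k' i then (k' i)%:~R else (k i)%:~R.
have n0 := exp2z_gt0 n.
apply: (@interior_not_const _ p (delta_mx ord0 i, 0) phi c (2 ^ n)^-1 _ nI).
- by rewrite invr_gt0.
- move=> q [/cell_image[/(_ i) + _] /cell_image[/(_ i) + _]].
  rewrite !mxE -/(phi q) /c => /andP[a1 a2] /andP[a3 a4].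
  have [lt|le] := ltP (k i) (k' i).
    have : (k i + 1)%:~R <= ((k' i)%:~R : R) by rewrite ler_int; lia.
    by rewrite intrD => a5; lra.
  have : (k' i + 1)%:~R <= ((k i)%:~R : R) by rewrite ler_int; lia.
  by rewrite intrD => a5; lra.
- by move=> s; rewrite /phi /= !mxE !eqxx /GRing.scale /= mulr1 addrAC mulrDl.
Qed.

Lemma interior_tile_layers n o k n' o' k' : n < n' ->
  interior (tile n o k) `&` interior (tile n' o' k') = set0.
Proof.
move=> nn'; apply/seteqP; split=> // p [h1 h2].
have nI : nbhs p (tile n o k `&` tile n' o' k') by exact: filterI.
apply: (@interior_not_const _ p (0, 1) snd (2 ^ n) 1 _ nI) => //.
move=> q [/tile_height[a1 a2] /tile_height[a3 a4]].
have : (2 : R) ^ (n + 1) <= 2 ^ n' by apply: exp2z_le; lia.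
by rewrite exprzDr ?unitfE // expr1z; lra.
Qed.

Lemma exp2z_bracket (y : R) : 0 < y -> exists n : int, 2 ^ n <= 2 * y /\ y <= 2 ^ n.
Proof.
move=> y0.
have pw (x : R) : exists N : nat, x <= 2 ^+ N.
  exists (Num.bound `|x|); apply: le_trans (real_ler_norm (num_real x)) _.
  apply: le_trans (ltW (archi_boundP (normr_ge0 _))) _.
  by rewrite -natrX ler_nat ltnW // ltn_expl.
(* Scaling by 2^(N+1) lifts [y] above 1, so the least [m] with y 2^(N+1) <= 2^m is positive and its
   predecessor violates the bound. *)
have [N hN] := pw y^-1.
have ex : exists m, y * 2 ^+ N.+1 <= 2 ^+ m by exact: pw.
have [m hm mmin] := ex_minnP ex.
have N0 : 0 < (2 : R) ^+ N.+1 by rewrite exprn_gt0.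
have yN : 1 < y * 2 ^+ N.+1.
  have : y * y^-1 <= y * 2 ^+ N by rewrite ler_pM2l.
  by rewrite divff ?gt_eqF // exprS; lra.
have m0 : (0 < m)%N by case: (posnP m) hm => // -> /(lt_le_trans yN); rewrite expr0 ltxx.
exists (m%:Z - N.+1%:Z); rewrite exprzDr ?unitfE // -exprnN -!exprnP.
split; last by rewrite ler_pdivlMr.
rewrite ler_pdivrMr // -(prednK m0) exprS -mulrA ler_pM2l // ltW // ltNge.
by apply/negP => /mmin; rewrite leqNgt prednK // leqnn.
Qed.

Lemma tile_cover (o : int -> nat) p : 0 < p.2 -> exists n k, tile n (o n) k p.
Proof.
move=> p0; have [n [h1 h2]] := exp2z_bracket p0.
exists n; exists (fun i => Num.floor ((p.1 ord0 i - (o n)%:R) / 2 ^ n)).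
apply/cell_image; split=> [i|].
  rewrite !mxE; set z := (X in Num.floor X).
  have := floor_le_tmp z; have := floorD1_gt z.
  by rewrite -/z intrD => ? ?; apply/andP; split; lra.
have n0 := exp2z_gt0 n.
by rewrite /= ler_pdivlMr // ler_pdivrMr //; apply/andP; split; lra.
Qed.

End Cells.

(** * The tiling of a 2-adic integer *)

Section Tilings.
Variables (R : realType) (d : nat).
Hypothesis d_gt0 : (0 < d)%N.
Local Notation V := ('rV[R]_d * R)%type.
Implicit Types w : nat -> bool.

(* The corners of the layer n are the points of offset w n + 2^n Z^d; w is the
   sequence of binary digits of a 2-adic integer, whose truncations are the offsets. *)
Definition partial_sum w (m : nat) : nat := \sum_(j < m) w j * 2 ^ j.

(** The offset is 0 up to layer 0 included, so all the tilings share these layers. *)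
Definition offset w (n : int) : nat := if n is Posz m then partial_sum w m else 0.

Definition carry w (n : int) : bool := if n is Posz m then w m else false.

Definition tiling w : set (set V) :=
  [set t | exists n k, t = tile n (offset w n) k].

Lemma offsetS w n :
  (offset w (n + 1))%:R = (offset w n)%:R + (carry w n)%:R * 2 ^ n :> R.
Proof.
case: n => [m|m].
  have -> : Posz m + 1 = Posz m.+1 by lia.
  by rewrite /= /partial_sum big_ord_recr /= natrD natrM natrX.
rewrite [carry _ _]/= mul0r addr0; case: m => [|m].
  have -> : Negz 0 + 1 = Posz 0 by lia.
  by rewrite /= /partial_sum big_ord0.
by have -> : Negz m.+1 + 1 = Negz m by lia.
Qed.

Lemma partial_sum_lt w m : (partial_sum w m < 2 ^ m)%N.
Proof.
elim: m => [|m IH]; first by rewrite /partial_sum big_ord0.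
rewrite /partial_sum big_ord_recr /= -/(partial_sum w m) expnS.
by case: (w m); lia.
Qed.

Lemma partial_sum_inj w w' : partial_sum w =1 partial_sum w' -> w = w'.
Proof.
move=> h; apply/funext => m.
have := h m.+1; rewrite /partial_sum !big_ord_recr /= -!/(partial_sum _ m) h.
move=> /addnI /eqP; rewrite eqn_pmul2r ?expn_gt0 //.
by case: (w m); case: (w' m).
Qed.

Lemma tiling_meet w n k n' k' : n <= n' ->
  tile n (offset w n) k <> tile n' (offset w n') k' :> set V ->
  let F : set V := tile n (offset w n) k `&` tile n' (offset w n') k' in
  (interior (tile n (offset w n) k : set V) `&`
   interior (tile n' (offset w n') k') = set0) /\
  (F = set0 \/ (tile_face (tile n (offset w n) k) F /\
                tile_face (tile n' (offset w n') k') F)).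
Proof.
rewrite le_eqVlt => /orP[/eqP <-|nn'] tt' F.
  have kk' : k <> k' by move=> e; apply: tt'; rewrite e.
  split; first exact: interior_tile_same_layer.
  have [|h] := @tile_same_layer R d n (offset w n) _ _ kk'; first by left.
  have [|h'] := @tile_same_layer R d n (offset w n) _ _ (nesym kk').
    by rewrite setIC; left.
  by right; split=> //; rewrite /F setIC.
split; first exact: interior_tile_layers.
have [n1|n1] := eqVneq n' (n + 1); last first.
  by left; apply: tile_far_layers; lia.
rewrite /F n1; apply: tile_next_layer; exact: offsetS.
Qed.

Lemma tiling_meet_sym w t t' : tiling w t -> tiling w t' -> t <> t' ->
  (interior t `&` interior t' = set0) /\
  (t `&` t' = set0 \/ (tile_face t (t `&` t') /\ tile_face t' (t `&` t'))).
Proof.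
move=> [n [k ->]] [n' [k' ->]] tt'.
have [nn'|/ltW nn'] := leP n n'; first exact: tiling_meet.
have [h1 h2] := tiling_meet nn' (nesym tt').
split; first by rewrite setIC.
by rewrite setIC; case: h2 => [|[]]; [left|right].
Qed.

Lemma tiling_B_tiling w : B_tiling (tiling w).
Proof.
split.
- split.
  + by move=> t [n [k ->]]; exact: tile_is_tile.
  + apply/seteqP; split=> [p [t [n [k ->]]]|p p0]; first exact: tile_gt0.
    have [n [k h]] := @tile_cover R d (offset w) p p0.
    by exists (tile n (offset w n) k) => //; exists n, k.
  + by move=> t t' Tt Tt' tt'; case: (tiling_meet_sym Tt Tt' tt').
- by move=> t t' Tt Tt' tt'; case: (tiling_meet_sym Tt Tt' tt').
- move=> d1 t t' E p q p' q' [n [k ->]] [n' [k' ->]] _.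
  move: p q p' q' E k k'; rewrite d1 => p q p' q' E k k'.
  by apply: oriented_cedge_agree; exact: exp2z_gt0.
Qed.

(** * Distinct sequences give distinct tilings *)

(** Two corners of the inner tile suffice: their heights force equal layers and, being opposite in
    every coordinate, they leave no room for a shift. *)
Lemma tile_sub n o k n' o' k' :
  (tile n o k : set V) `<=` tile n' o' k' ->
  n = n' /\ forall i, (o%:R + 2 ^ n * (k i)%:~R = o'%:R + 2 ^ n * (k' i)%:~R :> R).
Proof.
move=> sub.
have corner_in (n0 : int) (o0 : nat) (k0 : 'I_d -> int) s (y : R) : 2^-1 <= y <= 1 ->
    tile n0 o0 k0 (cell n0 o0 k0 (corner R s, y)).
  by move=> hy; exists (corner R s, y) => //; exact: prototile_corner.
have lo := sub _ (corner_in n o k (fun=> false) 2^-1 ltac:(apply/andP; split; lra)).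
have hi := sub _ (corner_in n o k (fun=> true) 1 ltac:(apply/andP; split; lra)).
have [lo1 _] := tile_height lo; have [_ hi1] := tile_height hi.
have nn' : n = n'.
  apply: (@ieexprIz R 2) => //; first by rewrite gt_eqF // ltr1n.
  move: lo1 hi1; rewrite /= !addr0 /GRing.scale /= mulr1 => ? ?.
  by apply: le_anti; apply/andP; split; lra.
subst n'; split=> // i.
have n0 := exp2z_gt0 R n.
move: lo hi => /cell_image[/(_ i) + _] /cell_image[/(_ i) + _].
pose A := (o%:R - o'%:R) / 2 ^ n + (k i)%:~R - (k' i)%:~R : R.
have E (c : R) : (2 ^ n * c + (o%:R + 2 ^ n * ((k i)%:~R + 2^-1)) - o'%:R) / 2 ^ n -
    (k' i)%:~R - 2^-1 = A + c by rewrite /A; field; rewrite gt_eqF.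
rewrite !mxE !E => /andP[a1 a2] /andP[a3 a4].
have A0 : A = 0 by lra.
apply/eqP; rewrite -subr_eq0; apply/eqP.
transitivity (2 ^ n * A); last by rewrite A0 mulr0.
by rewrite /A; field; rewrite gt_eqF.
Qed.

(** Layer [m] reveals the offset modulo 2^m. The truncation is less than 2^m, so it is
    determined. *)
Lemma tiling_inj w w' : tiling w = tiling w' -> w = w'.
Proof.
move=> e; apply: partial_sum_inj => m.
have : tiling w (tile m (partial_sum w m) (fun=> 0)) by exists m%:Z, (fun=> 0).
rewrite e => -[n [k tE]].
have [mn hk] : m%:Z = n /\ forall i, (partial_sum w m)%:R + 2 ^ (Posz m) * (0 : int)%:~R =
    (offset w' n)%:R + 2 ^ (Posz m) * (k i)%:~R :> R.
  by apply: tile_sub; rewrite tE.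
move: (hk (Ordinal d_gt0)); rewrite -{}mn /= mulr0 addr0.
set j := k _ => hj.
have /eqP : (Posz (partial_sum w m))%:~R =
    (Posz (partial_sum w' m) + Posz (2 ^ m)%N * j)%:~R :> R.
  by rewrite intrD intrM -!pmulrn natrX hj.
rewrite eqr_int => /eqP.
have := partial_sum_lt w m; have := partial_sum_lt w' m.
move: (partial_sum w m) (partial_sum w' m) (2 ^ m)%N j {hj} => a b c j h1 h2 h3.
have j0 : j = 0.
  have [j1|j1] := leP 1 j; first by nia.
  have [j2|j2] := leP j (-1); first by nia.
  by lia.
by move: h3; rewrite j0 mulr0 addr0 => -[].
Qed.
End Tilings.

(** * Counting congruence classes *)

Section Counting.
Variables (R : realType) (d : nat).
Hypothesis d_gt0 : (0 < d)%N.
Local Notation V := ('rV[R]_d * R)%type.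
Local Notation tiling := (@tiling R d).

(** The unit cube at the origin in layer 0, and the tile at the origin in layer -1 for height 1/4,
    belong to the tiling whatever [w] is. *)
Lemma base_point_corner w (j : option (option 'I_d)) : exists n k s,
  base_point R j = cell n (offset w n) k (corner R s, 2^-1).
Proof.
case: j => [[i|]|] /=.
- exists 0, (fun=> 0), (fun j => j == i).
  rewrite /cell /sim /= /partial_sum big_ord0; congr pair; last first.
    by rewrite /= addr0 expr0z /GRing.scale /= mul1r.
  apply/rowP => j; rewrite !mxE expr0z eqxx /= eq_sym.
  by rewrite eq_sym; case: (j == i); rewrite /=; lra.
- exists (Negz 0), (fun=> 0), (fun=> false).
  rewrite /cell (_ : (2 : R) ^ Negz 0 = 2^-1) // /sim /=; congr pair; last first.
    by rewrite /= addr0 /GRing.scale /=; lra.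
  by apply/rowP => j; rewrite !mxE; lra.
- exists 0, (fun=> 0), (fun=> false).
  rewrite /cell /sim /= /partial_sum big_ord0; congr pair; last first.
    by rewrite /= addr0 expr0z /GRing.scale /= mul1r.
  by apply/rowP => j; rewrite !mxE expr0z; lra.
Qed.

(** The offset is stored as a number, so that a code makes no reference to a sequence; finite
    functions keep the type countable. *)
Local Notation corner_code := (int * nat * {ffun 'I_d -> int} * {ffun 'I_d -> bool})%type.

Definition decode (c : corner_code) : V :=
  let: (n, o, k, s) := c in cell n o k (corner R s, 2^-1).

Lemma congruence_corner f w w' n k s : hyp_isometry f ->
  tiling w' = [set f @` t | t in tiling w] ->
  exists c, f (cell n (offset w n) k (corner R s, 2^-1)) = decode c.
Proof.
move=> fi e.
have : tiling w' (f @` tile n (offset w n) k).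
  by rewrite e; exists (tile n (offset w n) k) => //; exists n, k.
move=> [n' [k' tE]].
have sub : f @` tile n (offset w n) k `<=` tile n' (offset w' n') k' by rewrite tE.
have [s' es] := @hyp_isometry_corner R d d_gt0 f _ _ _ _ s fi (exp2z_gt0 R n) (exp2z_gt0 R n') sub.
rewrite {1}/cell es.
exists (n', offset w' n', [ffun i => k' i], [ffun i => s' i]) => /=.
congr sim; first by apply/rowP => i; rewrite !mxE ffunE.
by congr pair; apply/rowP => i; rewrite !mxE ffunE.
Qed.

Definition encodes w w' (c : {ffun option (option 'I_d) -> corner_code}) : Prop :=
  exists f, [/\ hyp_isometry f, tiling w' = [set f @` t | t in tiling w] &
    forall j, f (base_point R j) = decode (c j)].

Lemma congruent_encodes w w' : congruent (tiling w) (tiling w') ->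
  exists c, encodes w w' c.
Proof.
move=> [f fi e].
have /choice[c hc] : forall j, exists c, f (base_point R j) = decode c.
  move=> j; have [n [k [s ->]]] := base_point_corner w j.
  exact: congruence_corner fi e.
by exists (finfun c), f; split=> // j; rewrite ffunE.
Qed.

(** The code fixes the isometry at the base points, hence on the half-space, which contains all
    tiles; so it fixes the image of [tiling w]. *)
Lemma encodes_inj w w1 w2 c : encodes w w1 c -> encodes w w2 c -> w1 = w2.
Proof.
move=> [f [fi fE fc]] [g [gi gE gc]]; apply: (@tiling_inj R d d_gt0).
have fg p : 0 < p.2 -> f p = g p.
  by apply: hyp_isometry_eq => // j; rewrite fc gc.
rewrite fE gE; apply/seteqP.
by split=> _ [t [n [k ->]] <-]; exists (tile n (offset w n) k); try (by exists n, k);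
  apply/seteqP; split=> _ [p tp <-]; exists p => //; rewrite fg //; exact: tile_gt0 tp.
Qed.

Lemma congruent_refl (T : set (set V)) : congruent T T.
Proof.
exists (sim 1 0); first exact: hyp_isometry_sim.
have simE : @sim R d 1 0 = id.
  by apply/funext => p; rewrite /sim scale1r -[(0, 0)]/(0 : V) addr0.
apply/seteqP; split=> t.
  by move=> Tt; exists t; rewrite // simE image_id.
by move=> [s Ts <-]; rewrite simE image_id.
Qed.

(** Cantor's diagonal argument: [g] inverts [F] on its range and is the constant false sequence
    elsewhere, and [D] contradicts itself at [F D]. *)
Lemma bool_seq_not_countable (F : (nat -> bool) -> nat) : ~ injective F.
Proof.
move=> Finj; pose g n := xget (fun=> false) [set w | F w = n].
pose D n := ~~ g n n.
have gD : g (F D) = D.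
  by apply: Finj; apply: (@xgetPex _ (fun=> false) [set w | F w = F D]); exists D.
have : D (F D) = ~~ D (F D) by rewrite {1}/D gD.
by case: (D _).
Qed.

(** With countably many classes, a sequence would be determined by the number of its class and the
    code of a congruence from a chosen representative, so binary sequences would inject into the
    naturals. *)
Lemma congruence_classes_not_countable :
  ~ countable [set congruence_class T | T in @B_tiling R d].
Proof.
move=> /countable_injP[c cinj].
pose cl w := congruence_class (tiling w).
have clA w : cl w \in [set congruence_class T | T in @B_tiling R d].
  by rewrite inE; exists (tiling w) => //; exact: tiling_B_tiling.
(* [r n] is a sequence whose tiling represents the class numbered [n], if there is one. *)
pose r n := xget (fun=> false) [set w | c (cl w) = n].
have clr w : cl (r (c (cl w))) = cl w.
  apply: cinj => //.
  by apply: (@xgetPex _ (fun=> false) [set w' | c (cl w') = c (cl w)]); exists w.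
have /choice[e he] : forall w, exists b, encodes (r (c (cl w))) w b.
  move=> w; apply: congruent_encodes.
  have clw : cl w (tiling w) by split; [exact: tiling_B_tiling|exact: congruent_refl].
  have [_ h] : cl (r (c (cl w))) (tiling w) by rewrite (clr w).
  exact: h.
apply: (@bool_seq_not_countable (fun w => pickle (c (cl w), e w))).
move=> w w' /(pcan_inj (@pickleK _)) [cE eE].
by apply: (encodes_inj (he w)); rewrite eE cE; exact: he.
Qed.

End Counting.

Theorem mainTheorem4 (R : realType) (d : nat) (hd : (1 <= d)%N) :
  ~ countable [set congruence_class T | T in @B_tiling R d].
Proof. exact: congruence_classes_not_countable. Qed.
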